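(* Let $p\in(0,1)$ and $q=1-p$. Consider the edge flipping with parameter $p$ on a connected graph $G$ with $n$ vertices and $m$ edges, and let $\delta$ be the minimum degree of a vertex of $G$. Then for every $c>0$, $$c\,\frac{m}{\delta}\;\le\; t_{\mathrm{mix}}(qe^{-2c})\;\le\;\frac{m}{\delta}\left(\log n+2c-\log q\right).$$
   Context: Edge flipping: let $G$ be a finite connected graph with at least one edge, with vertex set $V(G)$, and let $p\in(0,1)$, $q=1-p$. The edge flipping on $G$ with parameter $p$ is the discrete-time Markov chain on the set $\Omega=\{\text{blue},\text{red}\}^{V(G)}$ of vertex colorings in which, at each step, an edge of $G$ is chosen uniformly at random (independently of the past) and then, independently, both of its endpoints are (re)colored blue with probability $p$, or both are (re)colored red with probability $q$. It has a unique stationary distribution $\pi$. Total variation distance: $\|\mu-\nu\|_{TV}=\frac12\sum_{x\in\Omega}|\mu(x)-\nu(x)|$. With $P^t_z$ the law of the chain after $t$ steps started from $z\in\Omega$, put $d_{TV}(t)=\max_{z\in\Omega}\|P^t_z-\pi\|_{TV}$. The mixing time is $t_{\mathrm{mix}}(\epsilon)=\min\{t: d_{TV}(t)\le\epsilon\}$. Here $\log$ is the natural logarithm.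
   Formalization: The graphs K_2 and K_3 are excluded: on K_2 the lower bound fails for c > 1 (the chain is stationary after one step), and on K_3 the upper bound fails for small c and q near 1 (t_mix ≥ 2 but the bound is about 1.69 at q = 0.99, c = 0.01). *)

(* Defs.v *)
From HB Require Import structures.
From mathcomp Require Import all_boot all_order all_algebra.
From mathcomp Require Import all_classical all_reals all_analysis.

Set Implicit Arguments.
Unset Strict Implicit.
Unset Printing Implicit Defensive.

Import Order.TTheory GRing.Theory Num.Theory.
Local Open Scope ring_scope.

(* A finite simple graph is a finType V of vertices with a symmetric and
   irreflexive adjacency relation e; its edges are unordered pairs. *)

Definition edges (V : finType) (e : rel V) : {set {set V}} :=
  finset (fun A => [exists x, exists y, e x y && (A == [set x; y]%SET)]).

Definition connected_graph (V : finType) (e : rel V) : Prop :=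
  forall x y : V, connect e x y.

Definition complete_graph (V : finType) (e : rel V) : Prop :=
  forall x y : V, x != y -> e x y.

Definition degree (V : finType) (e : rel V) (v : V) : nat := #|e v|.

(* The default value #|V| exceeds every degree, so this is the minimum as soon
   as V is nonempty. *)
Definition min_degree (V : finType) (e : rel V) : nat :=
  \big[Order.min/#|V|]_(v : V) degree e v.

(* true is blue, false is red. *)
Definition coloring (V : finType) := {ffun V -> bool}.

Definition recolor (V : finType) (A : {set V}) (b : bool)
    (z : coloring V) : coloring V :=
  [ffun v => if v \in A then b else z v].

Section EdgeFlipping.
Variables (R : realType) (V : finType) (e : rel V) (p : R).

Definition flip_kernel (z y : coloring V) : R :=
  \sum_(A in edges e) (#|edges e|%:R)^-1 *
    (p * (recolor A true z == y)%:R + (1 - p) * (recolor A false z == y)%:R).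

Fixpoint flip_law (t : nat) (z y : coloring V) : R :=
  if t is t'.+1 then \sum_(w : coloring V) flip_law t' z w * flip_kernel w y
  else (z == y)%:R.

Definition is_stationary (pi : coloring V -> R) : Prop :=
  [/\ forall y, 0 <= pi y,
      \sum_(y : coloring V) pi y = 1
    & forall y, \sum_(w : coloring V) pi w * flip_kernel w y = pi y].

Definition tv_dist (mu nu : coloring V -> R) : R :=
  2^-1 * \sum_(x : coloring V) `|mu x - nu x|.

Definition d_tv (pi : coloring V -> R) (t : nat) : R :=
  \big[Num.max/0]_(z : coloring V) tv_dist (flip_law t z) pi.

(* The minimum over t : nat, with value +oo if no t qualifies; an upper bound
   on the mixing time thus includes the existence of such a t. *)
Definition t_mix (pi : coloring V -> R) (eps : R) : \bar R :=
  ereal_inf [set (t%:R)%:E | t in [set t : nat | d_tv pi t <= eps]]%classic.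

End EdgeFlipping.

(* Main.v *)
Require Import Defs.
From HB Require Import structures.
From mathcomp Require Import all_boot all_order all_algebra.
From mathcomp Require Import all_classical all_reals all_analysis.
From mathcomp Require Import ring lra zify.

Import Order.TTheory GRing.Theory Num.Theory.
Local Open Scope ring_scope.

(** Write n, m and delta as in the theorem, and x = delta / m for the
probability that a uniform edge contains a fixed vertex of minimum degree.

Lower bound.  Under one step the indicator that v is blue contracts towards
its stationary mean p by the factor 1 - deg v / m, the probability that the
edge misses v.  Started from the all-blue colouring, and tested at a vertex of
minimum degree, the total variation distance after t steps is therefore at
least q (1 - x)^t [tv_ge_miss].  On every graph allowed here x <= 1/2
[double_min_degree_le], so 1 - x >= exp(-2x), and a distance of at most
q exp(-2c) forces t >= c / x.

Upper bound.  Two copies of the chain driven by the same edges and coins agree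
on every vertex covered by a chosen edge, so the distance is at most U(t), the
probability that t uniform edges do not cover all vertices
[tv_le_uncovered].  The union bound U(t) <= n (1 - x)^t would give the real
threshold T = (log n + 2c - log q) / x, but the mixing time is an integer, so
the bound is needed already at t = floor T, that is, one must show
U(t) <= n exp(-x (t+1)) as soon as x (t+1) > log n [uncovered_le].  The unit
lost by rounding is recovered as follows.
- The probabilities of missing the n vertices sum to n - 2, because an edge
  has two ends.  Hence the sum of their t-th powers is at most
  (n - 2) (1 - x)^(t-1) [sum_miss_expr_le], which saves a factor on irregular
  graphs and agrees with n (1 - x)^t on regular ones.
- On [0, 1], (1 - x)^(t-1) exp(x (t+1)) is largest at x = 2 / (t+1), and the
  inequality exp y <= (2+y) / (2-y) at y = 2/t bounds it there by
  (t+1) / (t-1) [expX_decay].  The claim follows whenever t >= n - 1.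
- Since x <= 2/n and log n >= 2 (n-1) / n for n >= 5 [ln_ge_frac], the
  condition x (t+1) > log n does give t >= n - 1 for n >= 5; for n = 3 it
  follows from x <= 1/2 and log 3 >= 1.  Only n = 4, t = 2 remains, where two equal edges miss
  two vertices at once, and counting them once improves the union bound by
  1/m >= 1/6 [uncovered_two_le]. *)

(** * Degrees, edges and vertices *)

Lemma mem_edges {V : finType} (e : rel V) (x y : V) :
  e x y -> [set x; y]%SET \in edges e.
Proof.
move=> exy; rewrite inE; apply/existsP; exists x; apply/existsP; exists y.
by rewrite exy eqxx.
Qed.

Lemma edgesP {V : finType} (e : rel V) (A : {set V}) :
  reflect (exists x y, e x y /\ A = [set x; y]%SET) (A \in edges e).
Proof.
apply: (iffP idP) => [|[x [y [exy ->]]]]; last exact: mem_edges.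
by rewrite inE => /existsP[x /existsP[y /andP[exy /eqP AE]]]; exists x, y.
Qed.

Lemma card_edge {V : finType} {e : rel V} (e_irr : irreflexive e) {A : {set V}} :
  A \in edges e -> #|A| = 2%N.
Proof.
move=> /edgesP[x [y [exy ->]]]; rewrite cards2.
by case: eqVneq exy => // ->; rewrite e_irr.
Qed.

(** The map y |-> {v, y} is a bijection from the neighbours of v to the edges
through v. *)
Lemma degree_sum_edges {V : finType} {e : rel V} (e_sym : symmetric e)
    (e_irr : irreflexive e) (v : V) :
  degree e v = (\sum_(A in edges e) (v \in A))%N.
Proof.
transitivity #|[set A in edges e | v \in A]%SET|.
  symmetry; rewrite /degree.
  rewrite -(@card_in_imset _ _ (fun y => [set v; y]%SET) (e v)); last first.
    move=> y y' vy vy' /setP /(_ y); rewrite !inE eqxx orbT.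
    by case: eqVneq vy => [->|_ _ /esym/eqP//]; rewrite unfold_in e_irr.
  congr #|pred_of_set _|; apply/setP => A; rewrite inE; apply/andP/imsetP.
    move=> [/edgesP[x [y [exy ->]]]]; rewrite !inE => /orP[] /eqP ->.
      by exists y.
    by exists x; [rewrite unfold_in e_sym | rewrite finset.setUC].
  by move=> [y vy ->]; rewrite mem_edges // !inE eqxx.
rewrite -sum1_card big_mkcond [RHS]big_mkcond; move: (edges e) => E.
by apply: eq_bigr => A _; rewrite inE; case: (A \in E); case: (v \in A).
Qed.

Lemma sum_degree {V : finType} {e : rel V} (e_sym : symmetric e)
    (e_irr : irreflexive e) :
  (\sum_(v : V) degree e v = 2 * #|edges e|)%N.
Proof.
under eq_bigr do rewrite degree_sum_edges //.
have card2 (A : {set V}) : A \in edges e -> (\sum_(v : V) (v \in A) = 2)%N.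
  move=> /(card_edge e_irr) <-; rewrite -sum1_card [RHS]big_mkcond.
  by apply: eq_bigr => v _; case: ifP.
by rewrite exchange_big (eq_bigr _ card2) sum_nat_const mulnC.
Qed.

Lemma min_degree_le {V : finType} (e : rel V) (v : V) :
  (min_degree e <= degree e v)%N.
Proof. exact: (@bigmin_le _ nat V #|V| v (degree e)). Qed.

Lemma min_degree_attained {V : finType} (e : rel V) (v0 : V) :
  exists v, degree e v = min_degree e.
Proof.
have [|v _ h] := @eq_bigmin _ nat V #|V| v0 xpredT (degree e) isT.
  by move=> i _; rewrite leEnat; exact: max_card.
by exists v.
Qed.

Lemma min_degree_gt0 {V : finType} {e : rel V} (e_sym : symmetric e)
    (e_conn : connected_graph e) (e_edge : exists x y, e x y) :
  (0 < min_degree e)%N.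
Proof.
case: e_edge => x [y exy]; have [v <-] := min_degree_attained e x.
rewrite /degree; apply/card_gt0P.
have [->|vx] := eqVneq v x; first by exists y.
have /connectP[[|w s] /= vs Ex] := e_conn v x; first by rewrite Ex eqxx in vx.
by exists w; case/andP: vs.
Qed.

Lemma card_edges_le {V : finType} {e : rel V} (e_irr : irreflexive e) :
  (#|edges e| <= 'C(#|V|, 2))%N.
Proof.
rewrite -(card_draws V 2) subset_leq_card //; apply/fintype.subsetP => A eA.
by rewrite inE (card_edge e_irr eA).
Qed.

Lemma min_degree_mul_card {V : finType} {e : rel V} (e_sym : symmetric e)
    (e_irr : irreflexive e) :
  (#|V| * min_degree e <= 2 * #|edges e|)%N.
Proof.
rewrite -(sum_degree e_sym e_irr) -sum_nat_const leq_sum // => v _.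
exact: min_degree_le.
Qed.

Lemma card_ge3 {V : finType} {e : rel V} (e_sym : symmetric e)
    (e_irr : irreflexive e) (e_edge : exists x y, e x y) :
  ~ ((#|V| <= 3)%N /\ complete_graph e) -> (3 <= #|V|)%N.
Proof.
move=> hK; rewrite leqNgt; apply/negP => V2; apply: hK; split; first exact: ltnW.
case: e_edge => x [y exy].
have xy : x != y by apply: contraTneq exy => ->; rewrite e_irr.
have VE v : v \in [set x; y]%SET.
  suff -> : [set x; y]%SET = [set: V]%SET by [].
  by apply/eqP; rewrite eqEcard finset.subsetT cardsT cards2 xy.
move=> a b; move: (VE a) (VE b); rewrite !inE.
by move=> /orP[] /eqP -> /orP[] /eqP ->; rewrite ?eqxx // e_sym.
Qed.

(** With at least four vertices this is the handshake identity.  On three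
vertices, a missing edge has an endpoint of degree one, while connectedness
requires two edges. *)
Lemma double_min_degree_le {V : finType} {e : rel V} (e_sym : symmetric e)
    (e_irr : irreflexive e) (e_conn : connected_graph e)
    (e_edge : exists x y, e x y)
    (hK : ~ ((#|V| <= 3)%N /\ complete_graph e)) :
  (2 * min_degree e <= #|edges e|)%N.
Proof.
have V3 := card_ge3 e_sym e_irr e_edge hK.
have hs := min_degree_mul_card e_sym e_irr.
have d0 := min_degree_gt0 e_sym e_conn e_edge.
have [V4|V4] := ltnP 3 #|V|; first by nia.
suff : (min_degree e <= 1)%N by nia.
rewrite leqNgt; apply/negP => d2; apply: hK; split => // x y xy.
apply/negPn/negP => nexy; have := min_degree_le e x.
suff : (degree e x <= 1)%N by lia.
have : (degree e x <= #|~: [set x; y]%SET|)%N.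
  apply: subset_leq_card; apply/fintype.subsetP => w xw; rewrite !inE.
  apply/norP; split; apply: contraTneq xw => ->; rewrite unfold_in ?e_irr //.
by rewrite cardsCs finset.setCK cards2 xy; lia.
Qed.

(** * Exponential estimates *)

(** The difference of the two sides, divided by expR x, has derivative
1 - (1 + x) expR (- x), which is nonnegative. *)
Lemma expR_mul_le (R : realType) (x : R) :
  0 <= x -> expR x * (2 - x) <= 2 + x.
Proof.
move=> x0.
pose f (y : R) : R := (2 + y) * expR (- y) + y.
have df (y : R) : is_derive y 1 f (1 - (1 + y) * expR (- y)).
  rewrite /f; apply: is_derive_eq.
  rewrite /GRing.scale /=; ring.
have f0x : f 0 <= f x.
  apply: (@ger0_derive1_ndecr R f 0 x) => //.
  - move=> y _; rewrite derive1E derive_val subr_ge0 expRN.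
    by rewrite ler_pdivrMr ?expR_gt0 // mul1r expR_ge1Dx.
  - apply: derivable_within_continuous => y _; by case: (df y).
move: f0x; rewrite /f oppr0 expR0 expRN => h.
have ex := expR_gt0 x.
have : 2 - x <= (2 + x) / expR x by lra.
by rewrite ler_pdivlMr // mulrC.
Qed.

Lemma expRM_le (R : realType) (k : nat) (x : R) : 0 <= x -> x < 2 ->
  expR (k%:R * x) <= ((2 + x) / (2 - x)) ^+ k.
Proof.
move=> x0 x2; rewrite expRM_natl lerXn2r ?nnegrE ?expR_ge0 //.
  by apply: divr_ge0; lra.
by rewrite ler_pdivlMr ?expR_mul_le //; lra.
Qed.

(** Equality nearly holds at n = 5, where it reads expR (8/5) <= 5; larger n
follow from ln (n / 5) >= 1 - 5 / n. *)
Lemma ln_ge_frac (R : realType) (n : nat) : (5 <= n)%N ->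
  2 * (n.-1)%:R / n%:R <= ln (n%:R : R).
Proof.
move=> n5.
have n5R : 5 <= n%:R :> R by rewrite ler_nat.
have n0 : 0 < n%:R :> R by lra.
have h5 : 8 / 5 <= ln (5 : R).
  rewrite -ler_expR lnK ?posrE //.
  (* expR (8/5) is within one percent of 5, hence the short step 1/10. *)
  have := @expRM_le R 16 (1/10) ltac:(lra) ltac:(lra).
  have -> : 16%:R * (1 / 10) = 8 / 5 :> R by lra.
  have -> : (2 + 1 / 10) / (2 - 1 / 10) = 21 / 19 :> R by field.
  move/le_trans; apply; lra.
have -> : (n%:R : R) = 5 * (n%:R / 5) by field.
rewrite lnM ?posrE ?divr_gt0 //.
have : 1 - 5 / n%:R <= ln (n%:R / 5 : R).
  rewrite -[n%:R / 5]invrK lnV ?posrE ?invr_gt0 ?divr_gt0 // invf_div.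
  have := @le_ln1Dx R (5 / n%:R - 1).
  have h : 0 < 5 / n%:R :> R by rewrite divr_gt0.
  rewrite [1 + _]addrC subrK => /(_ ltac:(lra)); lra.
have -> : n.-1%:R = n%:R - 1 :> R by rewrite -subn1 natrB //; lia.
have -> : 5 * (n%:R / 5) = n%:R :> R by field.
have -> : 2 * (n%:R - 1) / n%:R = 2 - 2 / n%:R :> R by field; lra.
have h1 : (n%:R^-1 : R) <= 5^-1 by rewrite lef_pV2 ?posrE.
have h2 : (0 : R) < n%:R^-1 by rewrite invr_gt0.
lra.
Qed.

(** The function (1 - x) ^+ k * expR (x * (k+2)) of x <= 1 is maximal where
1 - x = k / (k+2); there it equals (k / (k+2)) ^+ k * expR 2, and
expR 2 <= ((k+2) / k) ^+ k.+1 is the (k+1)-st power of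
expR y <= (2 + y) / (2 - y) at y = 2 / (k+1). *)
Lemma expX_decay (R : realType) (k : nat) (x : R) : x <= 1 ->
  k%:R / k.+2%:R * (1 - x) ^+ k <= expR (- (x * k.+2%:R)).
Proof.
move=> x1; case: k => [|k]; first by rewrite mul0r mul0r expR_ge0.
set t := k.+1; pose r : R := t%:R / t.+2%:R.
have t0 : 0 < t%:R :> R by rewrite ltr0n.
have t2E : t.+2%:R = t%:R + 2 :> R by rewrite -addn2 natrD.
have t1E : t.+1%:R = t%:R + 1 :> R by rewrite -addn1 natrD.
have r0 : 0 < r by rewrite divr_gt0 // ltr0n.
(* The maximiser is 1 - x = r; 1 + y <= expR y at y = (1 - x) / r - 1 shows
   that the value there is not exceeded. *)
have h1 : (1 - x) ^+ t <= r ^+ t * expR (2 - x * t.+2%:R).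
  have -> : 2 - x * t.+2%:R = t%:R * ((1 - x) / r - 1) :> R.
    by rewrite /r t2E; field; apply/andP; split; lra.
  rewrite expRM_natl -exprMn lerXn2r ?nnegrE ?mulr_ge0 ?expR_ge0 ?subr_ge0 ?(ltW r0) //.
  rewrite -ler_pdivrMl // mulrC; have := expR_ge1Dx ((1 - x) / r - 1).
  by rewrite [1 + _]addrC subrK.
have h2 : r ^+ t.+1 * expR 2 <= 1.
  have := @expRM_le R t.+1 (2 / t.+1%:R) ltac:(by rewrite divr_ge0).
  rewrite ltr_pdivrMr ?ltr0n // -[X in X < _]mulr1 ltr_pM2l // ltr1n => /(_ isT).
  have -> : t.+1%:R * (2 / t.+1%:R) = 2 :> R by field; lra.
  have -> : (2 + 2 / t.+1%:R) / (2 - 2 / t.+1%:R) = r^-1 :> R.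
    rewrite /r invf_div t2E t1E; field; apply/and3P; split; lra.
  by rewrite exprVn => h; rewrite -ler_pdivlMl ?exprn_gt0 // mulr1.
have -> : - (x * t.+2%:R) = (2 - x * t.+2%:R) - 2 by ring.
rewrite expRB ler_pdivlMr ?expR_gt0 //.
apply: le_trans (_ : r * (r ^+ t * expR (2 - x * t.+2%:R)) * expR 2 <= _).
  by rewrite ler_wpM2r ?expR_ge0 // ler_wpM2l // ltW.
rewrite mulrA -exprS mulrAC -[leRHS]mul1r ler_wpM2r ?expR_ge0 //.
Qed.

(** * The transition operator *)

(** The transition operator: flip_mean e p f z is the mean of f after one step
from z, so that the law after t steps is read off the iterates on f. *)
Definition flip_mean {R : realType} {V : finType} (e : rel V) (p : R)
    (f : coloring V -> R) (z : coloring V) : R :=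
  \sum_(A in edges e) (#|edges e|%:R)^-1 *
    (p * f (recolor A true z) + (1 - p) * f (recolor A false z)).

Lemma sum_dirac {R : realType} {T : finType} (a : T) (f : T -> R) :
  \sum_y (a == y)%:R * f y = f a.
Proof.
rewrite (bigD1 a) //= eqxx mul1r big1 ?addr0 // => y.
by rewrite eq_sym => /negPf ->; rewrite mul0r.
Qed.

Lemma sum_flip_kernel {R : realType} {V : finType} (e : rel V) (p : R)
    (f : coloring V -> R) (z : coloring V) :
  \sum_y flip_kernel e p z y * f y = flip_mean e p f z.
Proof.
rewrite /flip_kernel (eq_bigr _ (fun y _ => mulr_suml _ _ _ (f y))) exchange_big /=.
apply: eq_bigr => A _.
rewrite -(sum_dirac (recolor A true z)) -(sum_dirac (recolor A false z)).
rewrite !mulr_sumr -big_split /= mulr_sumr; apply: eq_bigr => y _; ring.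
Qed.

Lemma sum_flip_law {R : realType} {V : finType} (e : rel V) (p : R) (t : nat)
    (f : coloring V -> R) (z : coloring V) :
  \sum_y flip_law e p t z y * f y = iter t (flip_mean e p) f z.
Proof.
elim: t f => [|t IHt] f; first exact: sum_dirac.
rewrite iterSr -IHt /= (eq_bigr _ (fun y _ => mulr_suml _ _ _ (f y))) exchange_big /=.
apply: eq_bigr => w _; rewrite -sum_flip_kernel mulr_sumr.
by apply: eq_bigr => y _; rewrite mulrA.
Qed.

Lemma sum_edges_const {R : realType} {V : finType} {e : rel V} (a : R) :
  (0 < #|edges e|)%N -> \sum_(A in edges e) (#|edges e|%:R)^-1 * a = a.
Proof.
by move=> m0; rewrite sumr_const -mulrnAl -mulr_natl divff ?mul1r // pnatr_eq0 -lt0n.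
Qed.

Lemma flip_mean_affine {R : realType} {V : finType} {e : rel V} {p : R}
    (a b : R) (f : coloring V -> R) (z : coloring V) : (0 < #|edges e|)%N ->
  flip_mean e p (fun y => a * f y + b) z = a * flip_mean e p f z + b.
Proof.
move=> m0; rewrite -[in RHS](sum_edges_const b m0) mulr_sumr -big_split /=.
by apply: eq_bigr => A _; ring.
Qed.

Lemma sum_flip_law1 {R : realType} {V : finType} {e : rel V} {p : R} (t : nat)
    (z : coloring V) : (0 < #|edges e|)%N ->
  \sum_y flip_law e p t z y = 1.
Proof.
move=> m0; rewrite -(eq_bigr _ (fun y _ => mulr1 _)) (sum_flip_law e p t (fun=> 1)).
elim: t => // t IHt; rewrite iterSr; suff -> : flip_mean e p (fun=> 1) = fun=> 1 by [].
by apply/funext => w; rewrite -[RHS](sum_edges_const 1 m0); apply: eq_bigr => A _; ring.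
Qed.

Lemma stationary_iter {R : realType} {V : finType} {e : rel V} {p : R}
    {mu : coloring V -> R} (mu_stat : is_stationary e p mu) (t : nat)
    (f : coloring V -> R) :
  \sum_w mu w * iter t (flip_mean e p) f w = \sum_w mu w * f w.
Proof.
case: mu_stat => _ _ muK; elim: t f => // t IHt f; rewrite iterSr IHt.
under eq_bigr do rewrite -sum_flip_kernel mulr_sumr.
rewrite exchange_big /=; apply: eq_bigr => y _; rewrite -[in RHS]muK mulr_suml.
by apply: eq_bigr => w _; rewrite mulrA.
Qed.

(** * Total variation through test functions *)

Lemma sum_test_diff {R : realType} {V : finType} (mu nu f : coloring V -> R) :
  \sum_y mu y = \sum_y nu y ->
  \sum_y mu y * f y - \sum_y nu y * f y =
  \sum_y (mu y - nu y) * (f y - 2^-1).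
Proof.
move=> E; under [RHS]eq_bigr do rewrite mulrBr mulrBl [_ * 2^-1]mulrC.
by rewrite !sumrB -mulr_sumr sumrB E subrr mulr0 subr0.
Qed.

(** As both functions have the same sum, f may be centred at 1/2, and then
|f - 1/2| <= 1/2. *)
Lemma tv_ge_test {R : realType} {V : finType} (mu nu f : coloring V -> R) :
  \sum_y mu y = \sum_y nu y -> (forall y, 0 <= f y <= 1) ->
  \sum_y mu y * f y - \sum_y nu y * f y <= tv_dist mu nu.
Proof.
move=> E f01; rewrite sum_test_diff // /tv_dist mulr_sumr ler_sum // => y _.
have := f01 y; case: (ger0P (mu y - nu y)) => ?; nra.
Qed.

(** The maximising test function is the indicator of nu <= mu. *)
Lemma tv_attained {R : realType} {V : finType} (mu nu : coloring V -> R) :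
  \sum_y mu y = \sum_y nu y ->
  exists2 f : coloring V -> R, forall y, 0 <= f y <= 1 &
    tv_dist mu nu = \sum_y mu y * f y - \sum_y nu y * f y.
Proof.
move=> E; exists (fun y => if nu y <= mu y then 1 else 0).
  by move=> y; case: ifP; rewrite lexx ler01.
rewrite sum_test_diff // /tv_dist mulr_sumr; apply: eq_bigr => y _.
by case: lerP => ?; lra.
Qed.

(** * The upper bound through uncovered vertices *)

(** The probability that D together with t uniform edges fails to cover V,
conditioned on the first edge. *)
Fixpoint uncovered {R : realType} {V : finType} (e : rel V) (t : nat)
    (D : {set V}) : R :=
  if t is t'.+1 then
    \sum_(A in edges e) (#|edges e|%:R)^-1 * uncovered e t' (D :|: A)%SET
  else (D != [set: V]%SET)%:R.

(** The coupling by common edges and coins: starting from colourings that agree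
on D, the two copies agree on D and on every vertex of a chosen edge, so a test
function with values in [0, 1] separates them only when these do not cover V. *)
Lemma flip_mean_coupling {R : realType} {V : finType} (e : rel V) (p : R)
    (p01 : 0 <= p <= 1) (f : coloring V -> R) (f01 : forall y, 0 <= f y <= 1)
    (t : nat) (D : {set V}) (z w : coloring V) :
  (forall v, v \in D -> z v = w v) ->
  iter t (flip_mean e p) f z - iter t (flip_mean e p) f w <= uncovered e t D.
Proof.
have /andP[p0 p1] := p01.
elim: t D z w => [|t IHt] D z w zw /=.
  have [DT|_] /= := eqVneq D [set: V]%SET; last by have := f01 z; have := f01 w; lra.
  have -> : z = w by apply/ffunP => v; rewrite zw // DT inE.
  by rewrite subrr.
rewrite [X in X - _]/flip_mean [X in _ - X]/flip_mean -sumrB ler_sum // => A _.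
rewrite -mulrBr ler_wpM2l ?invr_ge0 //.
have step b : iter t (flip_mean e p) f (recolor A b z) -
    iter t (flip_mean e p) f (recolor A b w) <= uncovered e t (D :|: A)%SET.
  apply: IHt => v; rewrite !ffunE inE => /orP[vD|->] //.
  by case: ifP => // _; exact: zw.
have := step true; have := step false; nra.
Qed.

(** Averaging the coupling bound over a stationary start w gives the distance
to stationarity. *)
Lemma tv_le_uncovered {R : realType} {V : finType} {e : rel V} {p : R}
    (p01 : 0 <= p <= 1) (m0 : (0 < #|edges e|)%N)
    {mu : coloring V -> R} (mu_stat : is_stationary e p mu) (t : nat) (z : coloring V) :
  tv_dist (flip_law e p t z) mu <= uncovered e t finset.set0.
Proof.
have [mu0 mu1 _] := mu_stat.
have [|f f01 ->] := tv_attained (flip_law e p t z) mu.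
  by rewrite mu1 sum_flip_law1.
rewrite sum_flip_law -(stationary_iter mu_stat t f).
set F := iter t _ f.
rewrite -[X in X - _]mul1r -mu1 mulr_suml -sumrB.
rewrite -[leRHS]mul1r -mu1 mulr_suml ler_sum // => w _.
rewrite -mulrBr ler_wpM2l //; apply: flip_mean_coupling => // v.
by rewrite inE.
Qed.

(** The probability that a uniform edge misses v. *)
Definition miss {R : realType} {V : finType} (e : rel V) (v : V) : R :=
  1 - (degree e v)%:R / #|edges e|%:R.

Lemma sum_edges_miss {R : realType} {V : finType} {e : rel V} (e_sym : symmetric e)
    (e_irr : irreflexive e) (m0 : (0 < #|edges e|)%N) (v : V) :
  \sum_(A in edges e) (#|edges e|%:R)^-1 * (v \notin A)%:R = miss e v :> R.
Proof.
rewrite /miss -[X in X - _](sum_edges_const 1 m0) degree_sum_edges //.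
rewrite natr_sum mulr_suml -sumrB; apply: eq_bigr => A _.
by case: (v \in A) => /=; ring.
Qed.

(** The union bound over the vertices outside D. *)
Lemma uncovered_le_sum {R : realType} {V : finType} {e : rel V} (e_sym : symmetric e)
    (e_irr : irreflexive e) (m0 : (0 < #|edges e|)%N) (t : nat) (D : {set V}) :
  uncovered e t D <= \sum_(v | v \notin D) miss e v ^+ t :> R.
Proof.
elim: t D => [|t IHt] D /=.
  case: eqVneq => [_|DT] /=; first by rewrite sumr_ge0.
  have /set0Pn[v] : (~: D != finset.set0)%SET.
    by apply: contraNneq DT => DC; rewrite -[D]finset.setCK DC finset.setC0.
  rewrite inE => vD; rewrite (bigD1 v) //= expr0 lerDl sumr_ge0 //.
apply: le_trans (_ : \sum_(A in edges e) (#|edges e|%:R)^-1 *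
    (\sum_(v | v \notin D) (v \notin A)%:R * miss e v ^+ t) <= _).
  apply: ler_sum => A _; rewrite ler_wpM2l ?invr_ge0 //.
  apply: le_trans (IHt _) _; rewrite big_mkcond [leRHS]big_mkcond ler_sum // => v _.
  by rewrite inE negb_or; case: (v \in D); case: (v \in A); rewrite /= ?mul1r ?mul0r.
under [leLHS]eq_bigr do rewrite mulr_sumr.
rewrite exchange_big /= ler_sum // => v _.
rewrite exprS -(sum_edges_miss e_sym e_irr m0 v) mulr_suml.
by under eq_bigr do rewrite mulrA.
Qed.

Lemma miss_ge0 {R : realType} {V : finType} {e : rel V} (e_sym : symmetric e)
    (e_irr : irreflexive e) (m0 : (0 < #|edges e|)%N) (v : V) :
  0 <= miss e v :> R.
Proof.
by rewrite -(sum_edges_miss e_sym e_irr m0) sumr_ge0 // => A _; rewrite mulr_ge0.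
Qed.

Lemma miss_le {R : realType} {V : finType} (e : rel V) (v : V) :
  miss e v <= 1 - (min_degree e)%:R / #|edges e|%:R :> R.
Proof.
by rewrite /miss lerD2l lerN2 ler_wpM2r ?invr_ge0 // ler_nat min_degree_le.
Qed.

(** An edge misses n - 2 vertices. *)
Lemma sum_miss {R : realType} {V : finType} {e : rel V} (e_sym : symmetric e)
    (e_irr : irreflexive e) (m0 : (0 < #|edges e|)%N) :
  \sum_(v : V) miss e v = #|V|%:R - 2 :> R.
Proof.
rewrite sumrB sumr_const -mulr_suml -natr_sum sum_degree // natrM mulfK //.
by rewrite pnatr_eq0 -lt0n.
Qed.

(** Keeping one factor of each power exact lets the handshake identity sum the
terms; only the other factors are bounded by that of a vertex of minimum
degree. *)
Lemma sum_miss_expr_le {R : realType} {V : finType} {e : rel V} (e_sym : symmetric e)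
    (e_irr : irreflexive e) (m0 : (0 < #|edges e|)%N) (k : nat) :
  \sum_(v : V) miss e v ^+ k.+1 <=
  (#|V|%:R - 2) * (1 - (min_degree e)%:R / #|edges e|%:R) ^+ k :> R.
Proof.
rewrite -(sum_miss e_sym e_irr m0) mulr_suml ler_sum // => v _.
have h0 := @miss_ge0 R V e e_sym e_irr m0 v.
rewrite exprS ler_wpM2l // lerXn2r ?nnegrE ?miss_le //.
exact: le_trans (miss_le e v).
Qed.

(** For n <= t + 1 the factor (n - 2) / n is at most (t - 1) / (t + 1), which
is what the exponential estimate needs. *)
Lemma uncovered_le_expR {R : realType} {V : finType} {e : rel V} (e_sym : symmetric e)
    (e_irr : irreflexive e) (m0 : (0 < #|edges e|)%N) (t : nat) :
  (1 < #|V|)%N -> (#|V| <= t.+1)%N ->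
  uncovered e t finset.set0 <=
  #|V|%:R * expR (- ((min_degree e)%:R / #|edges e|%:R * t.+1%:R)) :> R.
Proof.
case: t => [|k] V2 Vk; first by lia.
set x : R := _ / _.
have x0 : 0 <= x by rewrite divr_ge0.
have V2R : 2 <= #|V|%:R :> R by rewrite (ler_nat R 2).
have VkR : #|V|%:R <= k.+2%:R :> R by rewrite ler_nat.
have k2E : k.+2%:R = k%:R + 2 :> R by rewrite -addn2 natrD.
have x1 : 0 <= 1 - x.
  have /card_gt0P[v _] : (0 < #|V|)%N by lia.
  exact: le_trans (miss_ge0 e_sym e_irr m0 v) (miss_le e v).
apply: le_trans (uncovered_le_sum e_sym e_irr m0 _ _) _.
rewrite (eq_bigl xpredT); last by move=> v; rewrite inE.
apply: le_trans (sum_miss_expr_le e_sym e_irr m0 k) _; rewrite -/x.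
apply: le_trans (_ : #|V|%:R * (k%:R / k.+2%:R * (1 - x) ^+ k) <= _); last first.
  by rewrite ler_wpM2l // expX_decay //; lra.
rewrite mulrA ler_wpM2r ?exprn_ge0 // mulrA ler_pdivlMr ?ltr0n // k2E.
by move: VkR; rewrite k2E => VkR; nra.
Qed.

Lemma two_edges_uncovered {V : finType} {e : rel V} (e_irr : irreflexive e)
    {A : {set V}} (B : {set V}) : (4 <= #|V|)%N -> A \in edges e ->
  ((A :|: B != [set: V])%SET + (A == B) <= #|~: (A :|: B)%SET|)%N.
Proof.
move=> V4 eA; case: (eqVneq A B) => [<-|_].
  rewrite finset.setUid cardsCs finset.setCK (card_edge e_irr eA).
  by case: (_ != _); lia.
case: eqVneq => //= AB; rewrite card_gt0.
by apply: contraNneq AB => DC; rewrite -[(A :|: B)%SET]finset.setCK DC finset.setC0.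
Qed.

(** The union bound for two edges counts a repeated edge n - 2 >= 2 times, so
the probability 1 / m of a repetition can be subtracted. *)
Lemma uncovered_two_le {R : realType} {V : finType} {e : rel V} (e_sym : symmetric e)
    (e_irr : irreflexive e) (m0 : (0 < #|edges e|)%N) : (4 <= #|V|)%N ->
  uncovered e 2 finset.set0 <= \sum_(v : V) miss e v ^+ 2 - (#|edges e|%:R)^-1 :> R.
Proof.
move=> V4.
have one (A : {set V}) : A \in edges e ->
    uncovered e 1 A <=
    \sum_(v : V) (v \notin A)%:R * miss e v - (#|edges e|%:R)^-1 :> R.
  move=> eA; rewrite -[X in _ - X](_ :
    \sum_(B in edges e) (#|edges e|%:R)^-1 * (A == B)%:R = _); last first.
    rewrite (bigD1 A) //= eqxx mulr1 big1 ?addr0 // => B /andP[_].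
    by rewrite eq_sym => /negPf ->; rewrite mulr0.
  under eq_bigr do rewrite -(sum_edges_miss e_sym e_irr m0) mulr_sumr.
  rewrite exchange_big -sumrB /= ler_sum // => B _.
  under eq_bigr do rewrite mulrCA.
  rewrite -mulr_sumr -mulrBr ler_wpM2l ?invr_ge0 // lerBrDr.
  rewrite -natrD; apply: le_trans (_ : #|~: (A :|: B)%SET|%:R <= _).
    by rewrite ler_nat (two_edges_uncovered e_irr).
  rewrite -sum1_card natr_sum big_mkcond ler_sum // => v _.
  rewrite !inE negb_or.
  by case: (v \in A); case: (v \in B); rewrite /= ?mulr0 ?mul0r ?mulr1.
apply: le_trans (_ : \sum_(A in edges e) (#|edges e|%:R)^-1 *
  (\sum_(v : V) (v \notin A)%:R * miss e v - (#|edges e|%:R)^-1) <= _).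
  by apply: ler_sum => A eA; rewrite ler_wpM2l ?invr_ge0 // finset.set0U one.
under [leLHS]eq_bigr do rewrite mulrBr mulr_sumr.
rewrite sumrB sum_edges_const // lerD2r exchange_big /= ler_sum // => v _.
rewrite expr2 -[X in _ <= X * _](sum_edges_miss e_sym e_irr m0 v) mulr_suml.
by under eq_bigr do rewrite mulrA.
Qed.

(** The hypothesis forces n <= t + 1, except for n = 4 and t = 2. *)
Lemma uncovered_le {R : realType} {V : finType} {e : rel V} (e_sym : symmetric e)
    (e_irr : irreflexive e) (V3 : (3 <= #|V|)%N)
    (m0 : (0 < #|edges e|)%N) (dm : (2 * min_degree e <= #|edges e|)%N) (t : nat) :
  ln #|V|%:R < (min_degree e)%:R / #|edges e|%:R * t.+1%:R :> R ->
  uncovered e t finset.set0 <=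
  #|V|%:R * expR (- ((min_degree e)%:R / #|edges e|%:R * t.+1%:R)) :> R.
Proof.
move=> ht.
have [|tV] := leqP #|V| t.+1; first by apply: uncovered_le_expR => //; lia.
set x : R := _ / _ in ht *.
have m0R : 0 < #|edges e|%:R :> R by rewrite ltr0n.
have x0 : 0 <= x by rewrite divr_ge0.
have xh : x <= 1 / 2.
  rewrite /x ler_pdivrMr //.
  have : (2 * min_degree e)%:R <= #|edges e|%:R :> R by rewrite ler_nat.
  by rewrite natrM; lra.
have e3 : expR 1 <= 3 :> R.
  have := @expRM_le R 1 1 ltac:(lra) ltac:(lra).
  have -> : (2 + 1) / (2 - 1) = 3 :> R by field.
  by rewrite mulr1 expr1.
have lnV : 1 <= ln #|V|%:R :> R.
  rewrite -ler_expR lnK ?posrE ?ltr0n; last by lia.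
  by rewrite (le_trans e3) // (ler_nat R 3).
have t2 : (2 <= t)%N.
  have : (2 : R) < t.+1%:R by have := ler0n R t.+1; nra.
  by rewrite (ltr_nat R 2).
have [V5|V4] := leqP 5 #|V|.
  have n0 : 0 < #|V|%:R :> R by rewrite ltr0n; lia.
  have xn : x <= 2 / #|V|%:R.
    rewrite /x ler_pdivrMr // mulrAC ler_pdivlMr // -!natrM ler_nat.
    by have := min_degree_mul_card e_sym e_irr; lia.
  have hl := ln_ge_frac R _ V5.
  have : 2 * (#|V|.-1)%:R / #|V|%:R < 2 / #|V|%:R * t.+1%:R :> R.
    by apply: le_lt_trans hl (lt_le_trans ht _); rewrite ler_wpM2r.
  rewrite mulrAC ltr_pM2l ?divr_gt0 // ltr_nat; lia.
have [VE tE] : #|V| = 4%N /\ t = 2%N by split; lia.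
rewrite tE; apply: le_trans (uncovered_two_le e_sym e_irr m0 _) _; first by lia.
have h1 := @sum_miss_expr_le R V e e_sym e_irr m0 1.
rewrite -/x expr1 VE in h1.
have h2 : 1 / 6 <= (#|edges e|%:R)^-1 :> R.
  rewrite mul1r lef_pV2 ?posrE // (ler_nat R _ 6).
  by have := card_edges_le e_irr; rewrite VE.
have h3 : expR (3 / 2) <= 24 / 5 :> R.
  have := @expRM_le R 3 (1/2) ltac:(lra) ltac:(lra).
  have -> : 3%:R * (1 / 2) = 3 / 2 :> R by lra.
  have -> : (2 + 1 / 2) / (2 - 1 / 2) = 5 / 3 :> R by field.
  move/le_trans; apply; lra.
(* The bound to prove, 2 (1 - x) - 1/6 <= 4 expR (- 3 x), is sharpest at
   x = 1/2, where the tangent line of the right-hand side suffices. *)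
have h4 : 1 + (3 / 2 - x * 3) <= expR (3 / 2) * expR (- (x * 3)).
  by rewrite -expRD expR_ge1Dx.
rewrite VE.
have := expR_gt0 (- (x * 3)); nra.
Qed.

(** * The lower bound through the colour of one vertex *)

Lemma flip_mean_vertex {R : realType} {V : finType} {e : rel V} (e_sym : symmetric e)
    (e_irr : irreflexive e) (m0 : (0 < #|edges e|)%N) (p : R) (v : V) (z : coloring V) :
  flip_mean e p (fun y => (y v)%:R) z = miss e v * (z v)%:R + (1 - miss e v) * p.
Proof.
rewrite [(1 - _) * p]mulrBl mul1r -(sum_edges_miss e_sym e_irr m0).
rewrite -[X in _ + (X - _)](sum_edges_const p m0).
rewrite !mulr_suml -sumrB -big_split; apply: eq_bigr => A _.
by rewrite !ffunE; case: (v \in A) => /=; ring.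
Qed.

(** The centred indicator of the colour of v is an eigenfunction with
eigenvalue miss e v. *)
Lemma iter_flip_mean_vertex {R : realType} {V : finType} {e : rel V} (e_sym : symmetric e)
    (e_irr : irreflexive e) (m0 : (0 < #|edges e|)%N) (p : R) (v : V) (t : nat)
    (z : coloring V) :
  iter t (flip_mean e p) (fun y => (y v)%:R) z = miss e v ^+ t * ((z v)%:R - p) + p.
Proof.
elim: t z => [|t IHt] z; first by rewrite expr0 mul1r subrK.
rewrite iterS.
have -> : iter t (flip_mean e p) (fun y => (y v)%:R) =
    fun y => miss e v ^+ t * (y v)%:R + (p - miss e v ^+ t * p).
  by apply/funext => y; rewrite IHt; ring.
by rewrite flip_mean_affine // flip_mean_vertex // exprS; ring.
Qed.

(** The eigenfunction has stationary mean 0, and value 1 - p at the all-blue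
colouring. *)
Lemma tv_ge_miss {R : realType} {V : finType} {e : rel V} (e_sym : symmetric e)
    (e_irr : irreflexive e) (m0 : (0 < #|edges e|)%N) {p : R}
    {mu : coloring V -> R} (mu_stat : is_stationary e p mu) (v : V)
    (dv : (0 < degree e v)%N) (t : nat) :
  (1 - p) * miss e v ^+ t <= tv_dist (flip_law e p t [ffun=> true]) mu.
Proof.
have [_ mu1 _] := mu_stat.
set f := fun y : coloring V => (y v)%:R : R.
have muf : \sum_w mu w * f w = p.
  have := stationary_iter mu_stat 1 f.
  under [LHS]eq_bigr do rewrite iter_flip_mean_vertex // expr1 mulrDr mulrCA mulrBr.
  rewrite big_split -mulr_sumr sumrB -!mulr_suml mu1 mul1r /= -/f => E.
  have : (1 - miss e v) * (\sum_w mu w * f w - p) = 0 by rewrite /f in E *; lra.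
  have mv : 0 < 1 - miss e v :> R by rewrite /miss subKr divr_gt0 ?ltr0n.
  by move/eqP; rewrite mulf_eq0 gt_eqF // subr_eq0 => /eqP.
apply: le_trans (tv_ge_test (flip_law e p t [ffun=> true]) mu f _ _).
- by rewrite muf sum_flip_law iter_flip_mean_vertex // ffunE addrK mulrC.
- by rewrite mu1 sum_flip_law1.
- by move=> y; rewrite /f; case: (y v); rewrite lexx ler01.
Qed.

Lemma expR_le_subr (R : realType) (x : R) : 0 <= x <= 1 / 2 ->
  expR (- (2 * x)) <= 1 - x.
Proof.
move=> /andP[x0 x1]; rewrite expRN -div1r ler_pdivrMr ?expR_gt0 //.
have := expR_ge1Dx (2 * x); nra.
Qed.

(** * The mixing time *)

(* hK excludes exactly K_2 and K_3, where the bounds fail: on K_2 the chain is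
   stationary after one step, so the lower bound fails for c > 1, and on K_2
   and K_3 the upper bound fails for small c and q close to 1. *)
Theorem theorem3p2 (R : realType) (V : finType) (e : rel V)
    (e_sym : symmetric e) (e_irr : irreflexive e)
    (e_conn : connected_graph e)
    (e_edge : exists x y : V, e x y)
    (hK : ~ ((#|V| <= 3)%N /\ complete_graph e))
    (p q : R) (p_gt0 : 0 < p) (p_lt1 : p < 1) (hq : q = 1 - p)
    (pi : coloring V -> R) (pi_stat : is_stationary e p pi)
    (n m delta : nat)
    (hn : n = #|V|) (hm : m = #|edges e|) (hdelta : delta = min_degree e)
    (c : R) (c_gt0 : 0 < c) :
  ((c * (m%:R / delta%:R))%:E <= t_mix e p pi (q * expR (- (2 * c))))%E /\
  (t_mix e p pi (q * expR (- (2 * c))) <=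
     (m%:R / delta%:R * (ln n%:R + 2 * c - ln q))%:E)%E.
Proof.
have m0N : (0 < #|edges e|)%N.
  case: e_edge => x [y exy]; rewrite card_gt0; apply/set0Pn.
  by exists [set x; y]%SET; exact: mem_edges.
have V3 := card_ge3 e_sym e_irr e_edge hK.
have d0N := min_degree_gt0 e_sym e_conn e_edge.
have dm := double_min_degree_le e_sym e_irr e_conn e_edge hK.
have q0 : 0 < q by rewrite hq; lra.
have m0 : 0 < m%:R :> R by rewrite hm ltr0n.
have d0 : 0 < delta%:R :> R by rewrite hdelta ltr0n.
pose x : R := delta%:R / m%:R.
have x0 : 0 < x by rewrite divr_gt0.
have xV : m%:R / delta%:R = x^-1 :> R by rewrite invf_div.
have xh : x <= 1 / 2.
  rewrite /x ler_pdivrMr //.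
  have : (2 * min_degree e)%:R <= #|edges e|%:R :> R by rewrite ler_nat.
  by rewrite -hdelta -hm natrM; lra.
split.
  apply/ereal_infP => _ [t /= ht <-]; rewrite lee_fin xV leNgt; apply/negP => tc.
  have /card_gt0P[v0 _] : (0 < #|V|)%N by lia.
  have [v dv] := min_degree_attained e v0.
  have := tv_ge_miss e_sym e_irr m0N pi_stat v ltac:(by rewrite dv) t.
  have -> : miss e v = 1 - x by rewrite /miss dv -hdelta -hm.
  apply/negP; rewrite -ltNge.
  apply: le_lt_trans (_ : q * expR (- (2 * c)) < _).
    by apply: le_trans ht; exact: (le_bigmax _ (fun z => tv_dist (flip_law e p t z) pi)).
  rewrite hq ltr_pM2l -?hq //.
  apply: lt_le_trans (_ : expR (t%:R * - (2 * x)) <= _).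
    by rewrite ltr_expR; rewrite ltr_pdivlMr // in tc; lra.
  rewrite expRM_natl lerXn2r ?nnegrE ?expR_ge0 //; first by lra.
  by rewrite expR_le_subr // (ltW x0).
(* T is the claimed bound, and the distance is small already at its floor. *)
set T := m%:R / delta%:R * _.
have xT : x * T = ln n%:R + 2 * c - ln q by rewrite /T xV mulVKf // gt_eqF.
have lnq : ln q <= 0 by rewrite ln_le0 // hq; lra.
have lnn : 0 <= ln n%:R :> R by rewrite ln_ge0 // hn (ler_nat R 1); lia.
have T0 : 0 <= T by rewrite -(pmulr_rge0 _ x0) xT; lra.
have /andP[tT Tt] := truncn_itv T0.
set t := Num.truncn T in tT Tt.
apply: ge_ereal_inf; exists (t%:R)%:E; last by rewrite lee_fin.
exists t => //=; apply: bigmax_le => [|z _].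
  by rewrite mulr_ge0 ?expR_ge0 // ltW.
have p01 : 0 <= p <= 1 by rewrite !ltW.
have xTt : x * T < x * t.+1%:R by rewrite ltr_pM2l.
apply: le_trans (tv_le_uncovered p01 m0N pi_stat t z) _.
apply: le_trans (uncovered_le e_sym e_irr V3 m0N dm t _) _.
  by rewrite -hn -hm -hdelta -/x; lra.
rewrite -hn -hm -hdelta -/x.
have n0 : 0 < n%:R :> R by rewrite hn ltr0n (leq_trans _ V3).
rewrite -{1}(lnK (x := n%:R)) ?posrE // -{1}(lnK (x := q)) ?posrE //.
rewrite -!expRD ler_expR; lra.
Qed.
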